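(* If $0<\alpha\leq 1$ and $n\geq 2$ is an integer, then $C_0(\mathbb{R}^n,d_\infty^\alpha)=2^\alpha$, where $d_\infty(u,v)=\max_{1\leq i\leq n}|u_i-v_i|$ and $d_\infty^\alpha(u,v)=d_\infty(u,v)^\alpha$.
   Context: For a metric space $(X,d)$ and $\mu \geq 0$, say that $(X,d)$ satisfies the $(\mu,0)$-four-point inequality if for all $x,y,z,w\in X$, $d(x,y)+d(z,w)\le \mu\max\{d(x,z)+d(y,w),\ d(x,w)+d(y,z)\}$. The quadrilateral constant of $(X,d)$ is $C_0(X,d)=\inf\{\mu\geq 0 \mid (X,d)\text{ satisfies the }(\mu,0)\text{-four-point inequality}\}$. *)

(* Defs.v *)
From HB Require Import structures.
From mathcomp Require Import all_boot all_order all_algebra.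
From mathcomp Require Import all_classical all_reals all_analysis.
From mathcomp Require Import lra.

Set Implicit Arguments.
Unset Strict Implicit.
Unset Printing Implicit Defensive.

Import Order.TTheory GRing.Theory Num.Theory.

Local Open Scope classical_set_scope.
Local Open Scope ring_scope.

Definition four_point (R : realType) (X : metricType R) (mu : R) : Prop :=
  forall x y z w : X,
    mdist x y + mdist z w <=
      mu * Num.max (mdist x z + mdist y w) (mdist x w + mdist y z).

(* [inf] is real-valued (with [inf set0 = 0]); this is harmless, since the set
   below is bounded below by 0 and always contains 2 ([four_point2]). *)
Definition quadrilateral_constant (R : realType) (X : metricType R) : R :=
  inf [set mu : R | 0 <= mu /\ four_point X mu].

Lemma four_point2 (R : realType) (X : metricType R) : four_point X 2.
Proof.
move=> x y z w; set M := Num.max _ _.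
have h1 : mdist x z + mdist y w <= M by rewrite le_max lexx.
have h2 : mdist x w + mdist y z <= M by rewrite le_max lexx orbT.
have t1 := metric_triangle x z y; have t2 := metric_triangle x w y.
have t3 := metric_triangle z x w; have t4 := metric_triangle z y w.
move: t1 t2 t3 t4; rewrite (metric_sym z y) (metric_sym z x) (metric_sym w y).
lra.
Qed.

Section linf.
Context (R : realType) (n : nat).
Implicit Types u v w : 'rV[R]_n.

(* The terms are nonnegative, so the default value 0 does not affect the
   maximum when n > 0. *)
Definition linf_dist u v : R := \big[Num.max/0]_(i < n) `|u 0 i - v 0 i|.

Lemma linf_distxx u : linf_dist u u = 0.
Proof.
apply: big1_idem => [|i _]; first exact: maxxx.
by rewrite subrr normr0.
Qed.

Lemma linf_dist_ge u v i : `|u 0 i - v 0 i| <= linf_dist u v.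
Proof. exact: (le_bigmax _ (fun i => `|u 0 i - v 0 i|)). Qed.

Lemma linf_dist_eq0 u v : linf_dist u v = 0 -> u = v.
Proof.
move=> uv0; apply/rowP => i; apply/eqP; rewrite -subr_eq0 -normr_le0 -uv0.
exact: linf_dist_ge.
Qed.

Lemma linf_dist_sym u v : linf_dist u v = linf_dist v u.
Proof. by apply: eq_bigr => i _; rewrite distrC. Qed.

Lemma linf_dist_triangle v u w :
  linf_dist u w <= linf_dist u v + linf_dist v w.
Proof.
apply/bigmax_leP; split=> [|i _].
  by apply: addr_ge0; exact: bigmax_ge_id.
apply: le_trans (ler_distD (v 0 i) _ _) _.
by apply: lerD; exact: linf_dist_ge.
Qed.

Definition linf_space : Type := 'rV[R]_n.

HB.instance Definition _ := Choice.copy linf_space 'rV[R]_n.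
HB.instance Definition _ := isMetric.Build R linf_space
  linf_distxx linf_dist_eq0 linf_dist_sym linf_dist_triangle.

Lemma mdist_linfE (u v : linf_space) : mdist u v = linf_dist u v.
Proof. by []. Qed.

End linf.

Section snowflake.
Context (R : realType) (X : metricType R) (alpha : R) (alpha01 : 0 < alpha <= 1).

Let alpha0 : 0 < alpha. Proof. by case/andP: alpha01. Qed.
Let alpha1 : alpha <= 1. Proof. by case/andP: alpha01. Qed.

Definition snowflake_dist (x y : X) : R := mdist x y `^ alpha.

Lemma snowflake_distxx x : snowflake_dist x x = 0.
Proof. by rewrite /snowflake_dist mdistxx powR0// gt_eqF. Qed.

Lemma snowflake_dist_eq0 x y : snowflake_dist x y = 0 -> x = y.
Proof. by move/powR_eq0_eq0/mdist_positivity. Qed.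

Lemma snowflake_dist_sym x y : snowflake_dist x y = snowflake_dist y x.
Proof. by rewrite /snowflake_dist metric_sym. Qed.

Lemma powR_subadditive (a b : R) : 0 <= a -> 0 <= b ->
  (a + b) `^ alpha <= a `^ alpha + b `^ alpha.
Proof.
have powR0a : 0 `^ alpha = 0 :> R by rewrite powR0// gt_eqF.
rewrite !le_eqVlt => /predU1P[<- _|a0]; first by rewrite add0r powR0a add0r eqxx.
move=> /predU1P[<-|b0]; first by rewrite addr0 powR0a addr0 eqxx.
rewrite -le_eqVlt.
have s0 : 0 < a + b by rewrite addr_gt0.
have scale c : 0 < c -> c <= a + b ->
    c / (a + b) * (a + b) `^ alpha <= c `^ alpha.
  move=> c0 cs; have cs01 : 0 < c / (a + b) <= 1.
    by rewrite divr_gt0//= ler_pdivrMr// mul1r.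
  rewrite -[in leRHS](divfK (lt0r_neq0 s0) c) powRM ?(ltW s0)//; last first.
    by rewrite ltW//; case/andP: cs01.
  by rewrite ler_wpM2r ?powR_ge0// ger1_powR.
have := lerD (scale a a0 _) (scale b b0 _).
rewrite -mulrDl -mulrDl divff ?lt0r_neq0// mul1r; apply.
- by rewrite lerDl ltW.
- by rewrite lerDr ltW.
Qed.

Lemma snowflake_dist_triangle y x z :
  snowflake_dist x z <= snowflake_dist x y + snowflake_dist y z.
Proof.
apply: le_trans (powR_subadditive (mdist_ge0 x y) (mdist_ge0 y z)).
apply: ge0_ler_powR; rewrite ?nnegrE ?mdist_ge0 ?addr_ge0 ?mdist_ge0 ?(ltW alpha0)//.
exact: metric_triangle.
Qed.

(* The proof that 0 < alpha <= 1 is a parameter of the carrier: it is needed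
   for the triangle inequality of the metric instance. *)
Definition snowflake of 0 < alpha <= 1 : Type := X.

HB.instance Definition _ := Choice.copy (snowflake alpha01) X.
HB.instance Definition _ := isMetric.Build R (snowflake alpha01)
  snowflake_distxx snowflake_dist_eq0 snowflake_dist_sym snowflake_dist_triangle.

Lemma mdist_snowflakeE (x y : snowflake alpha01) :
  mdist x y = mdist (x : X) (y : X) `^ alpha.
Proof. by []. Qed.

End snowflake.

(* Main.v *)
Require Import Defs.
From mathcomp Require Import all_boot all_order all_algebra.
From mathcomp Require Import all_classical all_reals all_analysis.
From mathcomp Require Import lra.

(** The upper bound [2 `^ alpha] holds in the snowflake of every metric space.
    The points [x, z, y, w] form a quadrilateral with diagonals [xy] and [zw],
    and each side, together with either of its two neighbours, spans one of the
    diagonals.  Look at a shortest side: its two neighbours are opposite sides,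
    and by the triangle inequality one diagonal is at most twice the first
    neighbour and the other at most twice the second.  Raising to the power
    [alpha] gives the factor [2 `^ alpha] in front of the sum over that pair of
    opposite sides, which is one of the two sums in the maximum
    ([four_point_snowflake]).

    The bound is attained in dimension at least 2 by the points [e_i, - e_i,
    e_j, - e_j]: for the supremum metric the diagonals have length 2 and the
    four sides have length 1, so any admissible [mu] satisfies
    [2 * 2 `^ alpha <= mu * 2] ([four_point_linf_ge]). *)

Import Order.TTheory GRing.Theory Num.Theory.

Local Open Scope ring_scope.

(** For use with a diagonal [d], a side [m] that is at most as long as its
    neighbours, and a neighbour [a] that forms a triangle with [m] and [d]. *)
Lemma powR_le_double {R : realType} (alpha d m a : R) : 0 <= alpha ->
  0 <= d -> d <= m + a -> m <= a -> d `^ alpha <= 2 `^ alpha * a `^ alpha.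
Proof.
move=> alpha0 d0 dma ma; have d2a : d <= 2 * a by lra.
have a0 : 0 <= a by lra.
by rewrite -powRM// ge0_ler_powR// nnegrE; lra.
Qed.

(** The two neighbours of a side that is no longer than either of them are opposite
    to each other, and twice their lengths bound the two diagonals. *)
Lemma four_point_snowflake {R : realType} {alpha : R} (alpha01 : 0 < alpha <= 1)
    (X : metricType R) : four_point (snowflake X alpha01) (2 `^ alpha).
Proof.
have alpha0 : 0 <= alpha by case/andP: alpha01 => /ltW.
move=> x y z w; rewrite !mdist_snowflakeE.
set xz := @mdist R X x z; set yw := @mdist R X y w.
set xw := @mdist R X x w; set yz := @mdist R X y z.
set xy := @mdist R X x y; set zw := @mdist R X z w.
have xy0 : 0 <= xy := mdist_ge0 _ _; have zw0 : 0 <= zw := mdist_ge0 _ _.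
have xzy : xy <= xz + yz by rewrite /yz metric_sym; exact: metric_triangle.
have xwy : xy <= xw + yw by rewrite /yw metric_sym; exact: metric_triangle.
have zxw : zw <= xz + xw by rewrite /xz metric_sym; exact: metric_triangle.
have zyw : zw <= yz + yw by rewrite /yz metric_sym; exact: metric_triangle.
have to_max (a b : R) :
    a + b <= Num.max (xz `^ alpha + yw `^ alpha) (xw `^ alpha + yz `^ alpha) ->
    xy `^ alpha <= 2 `^ alpha * a -> zw `^ alpha <= 2 `^ alpha * b ->
    xy `^ alpha + zw `^ alpha <=
    2 `^ alpha * Num.max (xz `^ alpha + yw `^ alpha) (xw `^ alpha + yz `^ alpha).
  move=> abM xya zwb; apply: (@le_trans _ _ (2 `^ alpha * (a + b))).
    by rewrite mulrDr lerD.
  by rewrite ler_wpM2l ?powR_ge0.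
(* Some side is at most as long as both of its neighbours: a shortest one is. *)
have [[h1 h2]|[[h1 h2]|[[h1 h2]|[h1 h2]]]] :
  (xz <= yz /\ xz <= xw) \/ (yw <= yz /\ yw <= xw) \/
  (xw <= xz /\ xw <= yw) \/ (yz <= xz /\ yz <= yw) by lra.
- apply: (to_max (yz `^ alpha) (xw `^ alpha)).
  + by rewrite addrC le_max lexx orbT.
  + exact: powR_le_double alpha0 xy0 xzy h1.
  + exact: powR_le_double alpha0 zw0 zxw h2.
- apply: (to_max (xw `^ alpha) (yz `^ alpha)).
  + by rewrite le_max lexx orbT.
  + by apply: powR_le_double h2; rewrite // addrC.
  + by apply: powR_le_double h1; rewrite // addrC.
- apply: (to_max (yw `^ alpha) (xz `^ alpha)).
  + by rewrite addrC le_max lexx.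
  + exact: powR_le_double alpha0 xy0 xwy h2.
  + by apply: powR_le_double h1; rewrite // addrC.
- apply: (to_max (xz `^ alpha) (yw `^ alpha)).
  + by rewrite le_max lexx.
  + by apply: powR_le_double h1; rewrite // addrC.
  + exact: powR_le_double alpha0 zw0 zyw h2.
Qed.

Section lower_bound.
Context {R : realType} {n : nat}.
Implicit Types (i j : 'I_n) (a b : R).

(** Points on two different axes differ in each coordinate by the contribution of
    at most one of them, so sides of the cross of unit vectors stay within 1. *)
Lemma linf_dist_axis_le1 i j a b : i != j -> `|a| <= 1 -> `|b| <= 1 ->
  linf_dist (a *: delta_mx 0 i) (b *: delta_mx 0 j) <= 1.
Proof.
move=> ij a1 b1; apply/bigmax_leP; split=> // k _; rewrite !mxE !eqxx/=.
case: (eqVneq k i) => [->|_].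
  by rewrite (negbTE ij) mulr1 mulr0 subr0.
by case: (eqVneq k j) => _; rewrite ?mulr1 ?mulr0 sub0r normrN ?normr0.
Qed.

Lemma linf_dist_antipodal_ge2 i :
  2 <= linf_dist (1 *: delta_mx 0 i : 'rV[R]_n) (-1 *: delta_mx 0 i).
Proof.
apply: le_trans (linf_dist_ge _ _ i).
by rewrite !mxE !eqxx !mulr1 opprK ger0_norm.
Qed.

(** The four-point inequality is tested on the unit vectors of two axes and their
    opposites, the antipodal pairs being the diagonals. *)
Lemma four_point_linf_ge {alpha : R} (alpha01 : 0 < alpha <= 1) (mu : R) :
  (2 <= n)%N -> 0 <= mu -> four_point (snowflake (linf_space R n) alpha01) mu ->
  2 `^ alpha <= mu.
Proof.
move=> n2 mu0; have alpha0 : 0 <= alpha by case/andP: alpha01 => /ltW.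
pose i : 'I_n := Ordinal (ltnW n2); pose j : 'I_n := Ordinal n2.
pose e k a : linf_space R n := a *: delta_mx 0 k.
move=> /(_ (e i 1) (e i (-1)) (e j 1) (e j (-1))).
rewrite !mdist_snowflakeE !mdist_linfE => fp.
have diag k : 2 `^ alpha <= linf_dist (e k 1) (e k (-1)) `^ alpha.
  apply: ge0_ler_powR; rewrite ?nnegrE//; last exact: linf_dist_antipodal_ge2.
  exact: bigmax_ge_id.
have side a b : `|a| <= 1 -> `|b| <= 1 ->
    linf_dist (e i a) (e j b) `^ alpha <= 1.
  move=> a1 b1; have -> : 1 = 1 `^ alpha :> R by rewrite powR1.
  apply: ge0_ler_powR; rewrite ?nnegrE//; first exact: bigmax_ge_id.
  exact: linf_dist_axis_le1.
have M2 : Num.max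
    (linf_dist (e i 1) (e j 1) `^ alpha + linf_dist (e i (-1)) (e j (-1)) `^ alpha)
    (linf_dist (e i 1) (e j (-1)) `^ alpha + linf_dist (e i (-1)) (e j 1) `^ alpha)
    <= 1 + 1.
  by rewrite ge_max !lerD// side// ?normrN normr1.
have := le_trans (le_trans (lerD (diag i) (diag j)) fp) (ler_wpM2l mu0 M2).
lra.
Qed.

End lower_bound.

Theorem proposition6p3 (R : realType) (alpha : R) (halpha : 0 < alpha <= 1)
    (n : nat) (hn : (2 <= n)%N) :
  quadrilateral_constant (snowflake (linf_space R n) halpha) = 2 `^ alpha.
Proof.
have mem : [set mu : R | 0 <= mu /\
    four_point (snowflake (linf_space R n) halpha) mu]%classic (2 `^ alpha).
  by split; [exact: powR_ge0 | exact: four_point_snowflake].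
apply/eqP; rewrite eq_le; apply/andP; split.
  by apply: ge_inf mem; exists 0 => mu [].
apply: lb_le_inf; first by exists (2 `^ alpha).
by move=> mu [mu0]; exact: four_point_linf_ge.
Qed.
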